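(* Let $G$ be a discrete group and let $(X,p,B)$ be a discrete $G$-bundle for which the (discrete) action of $G$ on $X$ is smooth. Then $(X,p,B)$ is a smooth principal fiber $G$-bundle.
   Context: Smooth manifolds are Hausdorff and second countable. An action of a discrete group $G$ on a smooth manifold $X$ is a covering-space action if every $x\in X$ has a neighborhood $U$ with $U\cap U\cdot g=\emptyset$ for all $g\ne e$. It is discrete if it is a covering-space action and, for any two points $x,y\in X$ with different orbits, there are neighborhoods $U$ of $x$ and $V$ of $y$ whose orbits $U\cdot G$ and $V\cdot G$ are disjoint. For a smooth covering-space action, $X/G$ (quotient topology) carries the smooth structure for which the quotient map $\pi\colon X\to X/G$ is a local diffeomorphism. A discrete $G$-bundle is a triple $(X,p,B)$ with $X$ a smooth manifold carrying a discrete right action of $G$, and $p=f\circ\pi$ for some diffeomorphism $f\colon X/G\to B$. A smooth principal fiber $G$-bundle $(X,p,B,G)$ ($G$ a Lie group; here $G$ is a discrete group regarded as a $0$-dimensional Lie group) consists of smooth manifolds $X,B$, a smooth surjective map $p\colon X\to B$, a smooth right action of $G$ on $X$, and a family $\{(U_i,\psi_i)\}$ with $\{U_i\}$ an open cover of $B$ and diffeomorphisms $\psi_i\colon U_i\times G\to p^{-1}(U_i)$ such that $p\circ\psi_i$ is the projection on the first factor and $\psi_i(b,gh)=\psi_i(b,g)\cdot h$ for $b\in U_i$, $g,h\in G$. *)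

(* Defs.v *)
From HB Require Import structures.
From mathcomp Require Import all_boot all_order all_algebra.
From mathcomp Require Import all_classical all_reals all_analysis.

Set Implicit Arguments.
Unset Strict Implicit.
Unset Printing Implicit Defensive.

Import Order.TTheory GRing.Theory Num.Theory.
Import numFieldNormedType.Exports.

Local Open Scope classical_set_scope.
Local Open Scope ring_scope.
Local Open Scope quotient_scope.

(** * Smooth maps between open subsets of Euclidean spaces *)

(* Maps are total; for open [A] only the values of [f] on [A] matter. The
   clause for [k.+1] says that the differential of [f] exists on [A] and is of
   class C^k, the differential at [x] being given by its values
   ['D_v f x = 'd f x v]. *)
Fixpoint class_C (R : realType) (m n k : nat) (A : set 'rV[R]_m)
    (f : 'rV[R]_m -> 'rV[R]_n) : Prop :=
  match k with
  | 0 => forall x, A x -> {for x, continuous f}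
  | k'.+1 => (forall x, A x -> differentiable f x) /\
             (forall v, class_C k' A (fun x => 'D_v f x))
  end.

Definition class_Coo (R : realType) (m n : nat) (A : set 'rV[R]_m)
    (f : 'rV[R]_m -> 'rV[R]_n) : Prop :=
  forall k, class_C k A f.

(** * Smooth manifolds *)

(* [cmap] is meaningful on [cdom] only, and [cinv] on [cmap @` cdom] only. *)
Record chart (R : realType) (n : nat) (M : Type) := Chart {
  cdom : set M ;
  cmap : M -> 'rV[R]_n ;
  cinv : 'rV[R]_n -> M }.

Definition cimg (R : realType) (n : nat) (M : Type) (c : chart R n M) :
  set 'rV[R]_n := cmap c @` cdom c.

(* [c] is a homeomorphism from an open subset of [M] to one of [R^n]. *)
Definition chart_ok (R : realType) (n : nat) (M : topologicalType)
    (c : chart R n M) : Prop :=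
  [/\ open (cdom c), open (cimg c),
      (forall x, cdom c x -> cinv c (cmap c x) = x),
      (forall x, cdom c x -> {for x, continuous (cmap c)}) &
      (forall v, cimg c v -> {for v, continuous (cinv c)})].

Definition atlas (R : realType) (n : nat) (M : Type) := set (chart R n M).

(* Atlases are not required to be maximal: an atlas stands for the smooth
   structure it generates. *)
Definition smooth_structure (R : realType) (n : nat) (M : topologicalType)
    (AM : atlas R n M) : Prop :=
  [/\ (forall c, AM c -> chart_ok c),
      (forall x, exists2 c, AM c & cdom c x) &
      (forall c d, AM c -> AM d ->
        class_Coo (cmap c @` (cdom c `&` cdom d)) (cmap d \o cinv c))].

Definition smooth_manifold (R : realType) (n : nat) (M : topologicalType)
    (AM : atlas R n M) : Prop :=
  [/\ smooth_structure AM, hausdorff_space M & @second_countable M].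

(* [D] is meant to be open; this is smoothness of the restriction of [f] to the
   open submanifold [D]. *)
Definition smooth_on (R : realType) (m n : nat) (M N : topologicalType)
    (AM : atlas R m M) (AN : atlas R n N) (D : set M) (f : M -> N) : Prop :=
  (forall x, D x -> {for x, continuous f}) /\
  (forall c d, AM c -> AN d ->
    class_Coo (cmap c @` (cdom c `&` D `&` f @^-1` cdom d))
              (cmap d \o f \o cinv c)).

Definition diffeo_on (R : realType) (m n : nat) (M N : topologicalType)
    (AM : atlas R m M) (AN : atlas R n N) (D : set M) (E : set N)
    (f : M -> N) : Prop :=
  [/\ open D, open E, smooth_on AM AN D f &
      exists g : N -> M,
        [/\ smooth_on AN AM E g,
            (forall x, D x -> E (f x) /\ g (f x) = x) &
            (forall y, E y -> D (g y) /\ f (g y) = y)]].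

Definition diffeo (R : realType) (m n : nat) (M N : topologicalType)
    (AM : atlas R m M) (AN : atlas R n N) (f : M -> N) : Prop :=
  diffeo_on AM AN setT setT f.

Definition local_diffeo (R : realType) (m n : nat) (M N : topologicalType)
    (AM : atlas R m M) (AN : atlas R n N) (f : M -> N) : Prop :=
  forall x, exists2 U, U x & diffeo_on AM AN U (f @` U) f.

Definition prod_chart (R : realType) (m n : nat) (M N : Type)
    (c : chart R m M) (d : chart R n N) : chart R (m + n) (M * N) :=
  Chart (cdom c `*` cdom d)
        (fun u => row_mx (cmap c u.1) (cmap d u.2))
        (fun v => (cinv c (lsubmx v), cinv d (rsubmx v))).

Definition prod_atlas (R : realType) (m n : nat) (M N : Type)
    (AM : atlas R m M) (AN : atlas R n N) : atlas R (m + n) (M * N)%type :=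
  [set prod_chart c d | c in AM & d in AN].

(** * Lie groups and discrete groups *)

#[short(type="spaceGroupType")]
HB.structure Definition SpaceGroup := {G of Group G & Topological G}.

#[short(type="discreteGroupType")]
HB.structure Definition DiscreteGroup := {G of Group G & DiscreteTopology G}.

(* Second countability is left out, so that every discrete group is a
   0-dimensional Lie group, whatever its cardinality. *)
Definition lie_group (R : realType) (k : nat) (G : spaceGroupType)
    (AG : atlas R k G) : Prop :=
  [/\ smooth_structure AG, hausdorff_space G,
      smooth_on (prod_atlas AG AG) AG setT (fun u : G * G => (u.1 * u.2)%g) &
      smooth_on AG AG setT (fun g : G => (g^-1)%g)].

Definition discrete_atlas (R : realType) (G : Type) : atlas R 0 G :=
  range (fun g : G => Chart [set g] (fun _ => 0) (fun _ => g)).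
Arguments discrete_atlas : clear implicits.

(** * Group actions and orbit spaces *)

Record right_action (X : Type) (G : groupType) := RightAction {
  act :> X -> G -> X ;
  act1 : forall x, act x 1%g = x ;
  actM : forall x g h, act x (g * h)%g = act (act x g) h }.

Section OrbitSpace.
Context (X : topologicalType) (G : groupType) (a : right_action X G).

Definition orbit_rel : rel X := fun x y => `[< exists g, y = a x g >].

Lemma orbit_rel_refl : reflexive orbit_rel.
Proof. by move=> x; apply/asboolP; exists 1%g; rewrite act1. Qed.

Lemma orbit_rel_sym : symmetric orbit_rel.
Proof.
have H x y : orbit_rel x y -> orbit_rel y x.
  move=> /asboolP[g ->]; apply/asboolP; exists (g^-1)%g.
  by rewrite -actM mulgV act1.
by move=> x y; apply/idP/idP; exact: H.
Qed.

Lemma orbit_rel_trans : transitive orbit_rel.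
Proof.
move=> y x z /asboolP[g ->] /asboolP[h ->]; apply/asboolP.
by exists (g * h)%g; rewrite actM.
Qed.

Definition orbit_equiv : equiv_rel X :=
  EquivRel orbit_rel orbit_rel_refl orbit_rel_sym orbit_rel_trans.

Definition orbit_space : topologicalType :=
  quotient_topology {eq_quot orbit_equiv}%qT.

Definition orbit_pi (x : X) : orbit_space := (\pi_{eq_quot orbit_equiv} x)%qT.

Definition saturation (U : set X) : set X :=
  [set a x g | x in U & g in [set: G]].

Definition covering_action : Prop :=
  forall x : X, exists2 U, nbhs x U &
    forall g, g <> 1%g -> U `&` (a^~ g @` U) = set0.

Definition discrete_action : Prop :=
  covering_action /\
  forall x y : X, (forall g, a x g <> y) ->
    exists U V, [/\ nbhs x U, nbhs y V & saturation U `&` saturation V = set0].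

End OrbitSpace.

(* The group is discrete: smoothness is required of each translation. *)
Definition smooth_discrete_action (R : realType) (n : nat)
    (X : topologicalType) (AX : atlas R n X) (G : groupType)
    (a : right_action X G) : Prop :=
  forall g, smooth_on AX AX setT (a^~ g).

(** * Bundles *)

(* [AQ] is the smooth structure of [X/G]: the condition that [orbit_pi] be a
   local diffeomorphism determines it. *)
Definition discrete_bundle (R : realType) (n m : nat) (G : groupType)
    (X B : topologicalType) (AX : atlas R n X) (AB : atlas R m B)
    (a : right_action X G) (p : X -> B) : Prop :=
  [/\ smooth_manifold AX, smooth_manifold AB, discrete_action a &
      exists AQ : atlas R n (orbit_space a),
        [/\ smooth_structure AQ, local_diffeo AX AQ (orbit_pi a) &
            exists2 f : orbit_space a -> B,
              diffeo AQ AB f & p = f \o orbit_pi a]].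

Definition smooth_principal_bundle (R : realType) (n m k : nat)
    (G : spaceGroupType) (X B : topologicalType)
    (AX : atlas R n X) (AB : atlas R m B) (AG : atlas R k G)
    (a : right_action X G) (p : X -> B) : Prop :=
  [/\ smooth_manifold AX, smooth_manifold AB & lie_group AG] /\
  [/\ smooth_on AX AB setT p,
      (forall b, exists x, p x = b),
      smooth_on (prod_atlas AX AG) AX setT (fun u : X * G => a u.1 u.2) &
      exists (I : Type) (U : I -> set B) (psi : I -> B * G -> X),
        [/\ (forall i, open (U i)),
            \bigcup_i U i = setT,
            (forall i, diffeo_on (prod_atlas AB AG) AX
                         (U i `*` setT) (p @^-1` U i) (psi i)),
            (forall i b g, U i b -> p (psi i (b, g)) = b) &
            (forall i b g h, U i b ->
               psi i (b, (g * h)%g) = a (psi i (b, g)) h)]].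

(* Main.v *)
(* If [U] is a sheet of the local diffeomorphism [X -> X/G] and [s] a smooth
   section over its image, then [(b, g) |-> s b . g] trivializes the bundle: its
   inverse is [y |-> (p y, h y)], where [h] is locally constant because the
   action is free. Everything else reduces to the composition of smooth maps,
   whose core is that C^k maps between open subsets of Euclidean spaces compose.
   Finally, an orbit in the second countable space [X] is a discrete subset, so
   that [G] is countable as soon as [X] is nonempty. *)
Require Import Defs.
From HB Require Import structures.
From mathcomp Require Import all_boot all_order all_algebra.
From mathcomp Require Import all_classical all_reals all_analysis.

Set Implicit Arguments.
Unset Strict Implicit.
Unset Printing Implicit Defensive.

Import Order.TTheory GRing.Theory Num.Theory.
Import numFieldNormedType.Exports.

Local Open Scope classical_set_scope.
Local Open Scope ring_scope.

(** * Differentials: locality, linear maps and the product rule *)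

Section Differential.
Context {R : realType}.

(** The first-order expansion of [f] at [x] involves only values near [x], so it is an expansion of
    [g] as well; uniqueness of the differential then gives ['d g x = 'd f x]. *)
Lemma near_eq_differentiable (V W : normedModType R) (f g : V -> W) (x : V) :
  {near x, f =1 g} -> differentiable f x -> differentiable g x.
Proof.
move=> fg df.
have gE : g \o shift x = cst (g x) + 'd f x +o_ 0 id.
  apply/eqaddoE/eqaddoP => _/posnumP[e].
  have e0 : 0 < e%:num by [].
  have /eqaddoP/(_ _ e0) := diff_locally df.
  have : \forall y \near (0 : V), f (y + x) = g (y + x).
    move: fg; rewrite (near_shift 0 x); apply: filterS => y.
    by rewrite /= subr0.
  apply: filterS2 => y fgy.
  rewrite (_ : (_ - _) y = (g \o shift x - (cst (g x) + 'd f x)) y) //.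
  rewrite -[in RHS](nbhs_singleton fg).
  by congr (_ - _); rewrite /= /shift fgy.
have dE : 'd g x = 'd f x :> (V -> W).
  by apply: diff_unique => //; exact: diff_continuous.
by apply/diff_locallyP; rewrite dE; split=> //; exact: diff_continuous.
Qed.

(** In finite dimension [L] is the finite sum of the coordinate functions times the images of the
    basis vectors, and each such term is differentiable. *)
Lemma linear_rV_continuous (m : nat) (W : normedModType R)
  (L : {linear 'rV[R]_m -> W}) : continuous L.
Proof.
move=> x; apply: differentiable_continuous.
have LE : \sum_(j < m) (fun v : 'rV[R]_m => v 0 j *: L (delta_mx 0 j)) = L.
  apply/funext => v; rewrite fct_sumE [in RHS](row_sum_delta v) linear_sum.
  by apply: eq_bigr => j _; rewrite linearZ.
suff : differentiable
    (\sum_(j < m) (fun v : 'rV[R]_m => v 0 j *: L (delta_mx 0 j))) x.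
  by rewrite LE.
apply: differentiable_sum => j.
exact/differentiableZl/differentiable_coord.
Qed.

Lemma scaler_is_bilinear (V : lmodType R) :
  bilinear_for
    (GRing.Scale.Law.clone _ _ *:%R _) (GRing.Scale.Law.clone _ _ *:%R _)
    (fun (k : R^o) (v : V) => k *: v).
Proof.
split=> [u'|u] a x y; first by rewrite scalerDl -[in LHS]scalerA.
by rewrite scalerDr; congr (_ + _); rewrite scalerA mulrC -scalerA.
Qed.

(** The product rule, obtained by the chain rule from [y |-> (k y, w y)] followed by scaling, a
    continuous bilinear map once scalars are viewed in [R^o]. *)
Lemma is_diff_scale (V W : normedModType R) (k dk : V -> R) (w dw : V -> W) x :
  is_diff x k dk -> is_diff x w dw ->
  is_diff x (fun y => k y *: w y) (fun v => k x *: dw v + dk v *: w x).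
Proof.
move=> hk hw.
pose BM := bilinear_isBilinear.Build _ _ _ _ _ _ _ (@scaler_is_bilinear W).
pose b : {bilinear R^o -> W -> W} :=
  HB.pack (fun (k : R^o) (v : W) => k *: v) BM.
have cb : continuous (fun p : R * W => b p.1 p.2) by exact: scale_continuous.
have db := differentiable_bilin (k x, w x) cb.
have hp : is_diff x (fun y => (k y, w y)) (fun v => (dk v, dw v)).
  exact: is_diff_pair.
have hb : is_diff (k x, w x) (fun p : R * W => b p.1 p.2)
   (fun p : R * W => k x *: p.2 + p.1 *: w x).
  by apply: DiffDef db _; rewrite diff_bilin.
exact: (is_diff_comp hp hb).
Qed.

Lemma is_diff_coord m n (M : 'M[R]_(m, n)) i j :
  is_diff M (fun N : 'M[R]_(m, n) => N i j : R) (fun N => N i j).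
Proof.
have cl : linear (fun N : 'M[R]_(m, n) => N i j : R^o).
  by move=> a u v; rewrite !mxE.
pose cM := GRing.isLinear.Build _ _ _ _ _ cl.
pose c : {linear 'M[R]_(m, n) -> R^o} :=
  HB.pack (fun N : 'M[R]_(m, n) => N i j) cM.
apply: DiffDef; first exact: differentiable_coord.
by apply: (@diff_lin _ _ _ c); exact: coord_continuous.
Qed.

End Differential.

(** * The C^k calculus *)

Section ClassC.
Context {R : realType}.
Implicit Types m n l k : nat.

(** On an open set, equality at every point is equality near every point, so it passes to
    directional derivatives and the induction on [k] goes through. *)
Lemma class_C_ext m n k (A : set 'rV[R]_m) (f g : 'rV[R]_m -> 'rV[R]_n) :
  open A -> (forall x, A x -> f x = g x) -> class_C k A f -> class_C k A g.
Proof.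
move=> oA; elim: k f g => [|k IH] f g fg /=.
  move=> cf x Ax; have nfg : \forall y \near x, f y = g y.
    by apply: filterS (open_nbhs_nbhs (conj oA Ax)) => y /fg.
  move=> P gxP; have := cf x Ax P; rewrite (fg _ Ax) => /(_ gxP).
  by apply: filterS2 nfg => y /= ->.
have nfg x : A x -> {near x, f =1 g}.
  by move=> Ax; apply: filterS (open_nbhs_nbhs (conj oA Ax)) => y /fg.
move=> [df cf]; split=> [x Ax|v].
  exact: near_eq_differentiable (nfg x Ax) (df x Ax).
by apply: IH (cf v) => x Ax; exact/near_eq_derive/nfg.
Qed.

(** Continuity and derivatives are taken in the ambient space, never relative to [A], so each clause
    is a condition at one point at a time. Restriction and localization both follow from this. *)
Lemma class_CP m n k (A : set 'rV[R]_m) (f : 'rV[R]_m -> 'rV[R]_n) :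
  class_C k A f <-> forall x, A x -> class_C k [set x] f.
Proof.
elim: k f => [|k IH] f /=.
  by split=> [cf x Ax _ ->|cf x Ax]; [exact: cf|exact: (cf x Ax x)].
split=> [[df cf] x Ax|cf].
  by split=> [_ ->|v]; [exact: df|have /IH := cf v; exact].
split=> [x Ax|v]; first by have [+ _] := cf x Ax; exact.
by apply/IH => x Ax; have [] := cf x Ax.
Qed.

Lemma class_C_sub m n k (A B : set 'rV[R]_m) (f : 'rV[R]_m -> 'rV[R]_n) :
  A `<=` B -> class_C k B f -> class_C k A f.
Proof. by move=> AB /class_CP cf; apply/class_CP => x /AB; exact: cf. Qed.

Lemma class_CS m n k (A : set 'rV[R]_m) (f : 'rV[R]_m -> 'rV[R]_n) :
  class_C k.+1 A f -> class_C k A f.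
Proof.
elim: k f => [|k IH] f [df cf].
  by move=> x Ax; exact/differentiable_continuous/df.
by split=> // v; exact/IH/cf.
Qed.

Lemma class_C_cst m n k (A : set 'rV[R]_m) (c : 'rV[R]_n) :
  class_C k A (fun=> c).
Proof.
elim: k c => [|k IH] c /=; first by move=> x _; exact: cst_continuous.
split=> [x _|v]; first exact: differentiable_cst.
have -> : (fun x : 'rV[R]_m => 'D_v (fun=> c) x) = (fun=> 0); last exact: IH.
by apply/funext => x; rewrite derive_cst.
Qed.

Lemma class_C_linear m n k (A : set 'rV[R]_m)
  (L : {linear 'rV[R]_m -> 'rV[R]_n}) : class_C k A L.
Proof.
have Lc : continuous L by exact: linear_rV_continuous.
case: k => [|k]; first by move=> x _; exact: Lc.
split=> [x _|v]; first exact: linear_differentiable.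
have -> : (fun x : 'rV[R]_m => 'D_v L x) = (fun=> L v).
  apply/funext => x; rewrite deriveE ?diff_lin//.
  exact: linear_differentiable.
exact: class_C_cst.
Qed.

Lemma class_CD m n k (A : set 'rV[R]_m) (f g : 'rV[R]_m -> 'rV[R]_n) :
  open A -> class_C k A f -> class_C k A g -> class_C k A (fun x => f x + g x).
Proof.
move=> oA; elim: k f g => [|k IH] f g /=.
  by move=> cf cg x Ax; exact: (cvgD (cf x Ax) (cg x Ax)).
move=> [df cf] [dg cg]; split=> [x Ax|v].
  by apply: differentiableD; [exact: df|exact: dg].
apply: class_C_ext (IH _ _ (cf v) (cg v)) => // x Ax.
by rewrite -deriveD//; apply: diff_derivable; [exact: df|exact: dg].
Qed.

Lemma class_C_sum m n l k (A : set 'rV[R]_m)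
  (f : 'I_l -> 'rV[R]_m -> 'rV[R]_n) :
  open A -> (forall i, class_C k A (f i)) ->
  class_C k A (fun x => \sum_i f i x).
Proof.
move=> oA cf; elim: (index_enum _) => [|i s IH].
  by under eq_fun do rewrite big_nil; exact: class_C_cst.
by under eq_fun do rewrite big_cons; exact: class_CD.
Qed.

(** Covers the terms of the chain rule in coordinates. By the product rule the derivative is a sum
    of two products of the same shape; the factor left undifferentiated is lowered from [k.+1] to
    [k] by [class_CS]. *)
Lemma class_C_coord_scale m n l k (A : set 'rV[R]_m) (j : 'I_l)
  (h : 'rV[R]_m -> 'rV[R]_l) (w : 'rV[R]_m -> 'rV[R]_n) :
  open A -> class_C k A h -> class_C k A w ->
  class_C k A (fun x => h x 0 j *: w x).
Proof.
move=> oA; elim: k h w => [|k IH] h w /=.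
  move=> ch cw x Ax; apply: (cvgZ _ (cw x Ax)).
  exact: (cvg_comp _ _ (ch x Ax) (@coord_continuous _ _ _ 0 j (h x))).
move=> chw cww; have [[dh ch] [dw cw]] := (chw, cww).
have dhw x : A x -> is_diff x (fun y => h y 0 j *: w y)
    (fun v => h x 0 j *: 'd w x v + 'd h x v 0 j *: w x).
  move=> Ax; have dhx := differentiableP (dh x Ax).
  have dwx := differentiableP (dw x Ax).
  have djh : is_diff x (fun y => h y 0 j) (fun v => 'd h x v 0 j).
    exact: (is_diff_comp dhx (is_diff_coord (h x) 0 j)).
  exact: is_diff_scale.
split=> [x Ax|v]; first by have [] := dhw x Ax.
have := class_CD oA (IH _ _ (class_CS chw) (cw v))
  (IH _ _ (ch v) (class_CS cww)).
apply: class_C_ext => // x Ax; have [dx dE] := dhw x Ax.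
by rewrite (deriveE v dx) dE (deriveE v (dw x Ax)) (deriveE v (dh x Ax)).
Qed.

(* The chain rule expresses [D_v (g \o f)] through the [D_v f] and the partial
   derivatives of [g], composed with [f], which allows an induction on [k]. *)
Lemma class_C_comp m n l k (A : set 'rV[R]_m) (B : set 'rV[R]_n)
  (f : 'rV[R]_m -> 'rV[R]_n) (g : 'rV[R]_n -> 'rV[R]_l) :
  open A -> open B -> (forall x, A x -> B (f x)) ->
  class_C k A f -> class_C k B g -> class_C k A (g \o f).
Proof.
move=> oA oB AB; elim: k g => [|k IH] g.
  move=> cf cg x Ax; apply: continuous_comp; first exact: cf.
  exact/cg/AB.
move=> cff [dg cg]; have [df cf] := cff; split=> [x Ax|v].
  by apply: differentiable_comp; [exact: df|exact/dg/AB].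
pose t j x := 'D_v f x 0 j *: ('D_(delta_mx 0 j) g \o f) x.
have ct j : class_C k A (t j).
  by apply: class_C_coord_scale (cf v) _ => //; exact: IH (class_CS cff) (cg _).
apply: class_C_ext (class_C_sum oA ct) => // x Ax.
have dfx := df x Ax; have dgx := dg _ (AB x Ax).
rewrite (deriveE v (differentiable_comp dfx dgx)) diff_comp//= -(deriveE v dfx).
rewrite [in RHS](row_sum_delta ('D_v f x)) linear_sum.
by apply: eq_bigr => j _; rewrite linearZ /t /= (deriveE _ dgx).
Qed.

Lemma class_Coo_ext m n (A : set 'rV[R]_m) (f g : 'rV[R]_m -> 'rV[R]_n) :
  open A -> (forall x, A x -> f x = g x) -> class_Coo A f -> class_Coo A g.
Proof. by move=> oA fg cf k; exact: class_C_ext (cf k). Qed.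

Lemma class_Coo_sub m n (A B : set 'rV[R]_m) (f : 'rV[R]_m -> 'rV[R]_n) :
  A `<=` B -> class_Coo B f -> class_Coo A f.
Proof. by move=> AB cf k; exact: class_C_sub (cf k). Qed.

Lemma class_Coo_local m n (A : set 'rV[R]_m) (f : 'rV[R]_m -> 'rV[R]_n) :
  (forall x, A x -> exists2 B : set 'rV[R]_m, B x & class_Coo B f) ->
  class_Coo A f.
Proof.
move=> Af k; apply/class_CP => x /Af[B Bx cf].
by apply: class_C_sub (cf k) => _ ->.
Qed.

Lemma class_Coo_comp m n l (A : set 'rV[R]_m) (B : set 'rV[R]_n)
  (f : 'rV[R]_m -> 'rV[R]_n) (g : 'rV[R]_n -> 'rV[R]_l) :
  open A -> open B -> (forall x, A x -> B (f x)) ->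
  class_Coo A f -> class_Coo B g -> class_Coo A (g \o f).
Proof. by move=> oA oB AB cf cg k; exact: class_C_comp (cf k) (cg k). Qed.

End ClassC.

(** * Smooth maps between manifolds *)

Lemma open_setI_preimage (S T : topologicalType) (D : set S) (E : set T)
  (f : S -> T) : open D -> open E -> (forall x, D x -> {for x, continuous f}) ->
  open (D `&` f @^-1` E).
Proof.
rewrite !openE => oD oE cf x [Dx Ex]; apply: filterI; first exact: oD.
by apply: (cf x Dx); exact: oE.
Qed.

Section SmoothMaps.
Context {R : realType}.
Implicit Types (m n l : nat) (M N P : topologicalType).

(** Inside the open set [cimg c], the image of [E] is the preimage of [E] under [cinv c], which is
    continuous there. *)
Lemma chart_open_image m M (c : chart R m M) (E : set M) :
  chart_ok c -> open E -> E `<=` cdom c -> open (cmap c @` E).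
Proof.
move=> [_ oi cK _ ci] oE Ec.
rewrite (_ : _ @` _ = cimg c `&` cinv c @^-1` E).
  exact: open_setI_preimage.
apply/seteqP; split=> [_ [x Ex <-]|_ [[x cx <-]]].
  have cx := Ec _ Ex; split; first by exists x.
  by rewrite /= cK.
by rewrite /= cK// => Ex; exists x.
Qed.

Lemma smooth_on_sub m n M N (AM : atlas R m M) (AN : atlas R n N)
  (D E : set M) (f : M -> N) :
  D `<=` E -> smooth_on AM AN E f -> smooth_on AM AN D f.
Proof.
move=> DE [cf sf]; split=> [x /DE|c d Ac Ad]; first exact: cf.
apply: class_Coo_sub (sf c d Ac Ad) => _ [x [[? /DE ?] ?] <-].
by exists x.
Qed.

Lemma smooth_on_local m n M N (AM : atlas R m M) (AN : atlas R n N)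
  (D : set M) (f : M -> N) :
  (forall x, D x -> exists2 E, E x & smooth_on AM AN E f) ->
  smooth_on AM AN D f.
Proof.
move=> Df; split=> [x /Df[E Ex [cf _]]|c d Ac Ad]; first exact: cf.
apply: class_Coo_local => _ [x [[cx /Df[E Ex [_ sf]]] dx] <-].
by exists (cmap c @` (cdom c `&` E `&` f @^-1` cdom d)); [exists x|exact: sf].
Qed.

Lemma smooth_on_ext m n M N (AM : atlas R m M) (AN : atlas R n N)
  (D : set M) (f g : M -> N) :
  smooth_structure AM -> smooth_structure AN ->
  open D -> (forall x, D x -> f x = g x) ->
  smooth_on AM AN D f -> smooth_on AM AN D g.
Proof.
move=> [okM _ _] [okN _ _] oD fg [cf sf]; split=> [x Dx|c d Ac Ad].
  move=> U gxU; have := cf x Dx U; rewrite fg// => /(_ gxU).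
  apply: filterS2 (open_nbhs_nbhs (conj oD Dx)) => y /fg.
  by rewrite /preimage/= => ->.
have [oc _ cK _ _] := okM c Ac; have [od _ _ _ _] := okN d Ad.
have oDf : open (cdom c `&` D `&` f @^-1` cdom d).
  by rewrite -setIA; apply: openI => //; exact: open_setI_preimage.
have DgE : cdom c `&` D `&` g @^-1` cdom d = cdom c `&` D `&` f @^-1` cdom d.
  apply/seteqP; split=> x [[cx Dx]]; rewrite /= fg// => dx;
    by split; rewrite /= ?fg.
rewrite DgE; apply: class_Coo_ext (sf c d Ac Ad).
  by apply: chart_open_image => // [|x [[]]//]; exact: okM.
by move=> _ [x [[cx Dx] _] <-] /=; rewrite cK// fg.
Qed.

Lemma smooth_on_cst m n M N (AM : atlas R m M) (AN : atlas R n N)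
  (D : set M) (y : N) : smooth_on AM AN D (fun=> y).
Proof.
split=> [x _|c d _ _]; first exact: cst_continuous.
by move=> k; exact: class_C_cst.
Qed.

(** Around each point, a chart [e] of [N] at [f x] is inserted: the chart expression of [g \o f]
    factors there through those of [f] and [g], and the Euclidean composition result applies. *)
Lemma smooth_on_comp m n l M N P (AM : atlas R m M) (AN : atlas R n N)
  (AP : atlas R l P) (D : set M) (E : set N) (f : M -> N) (g : N -> P) :
  smooth_structure AM -> smooth_structure AN -> smooth_structure AP ->
  open D -> open E -> (forall x, D x -> E (f x)) ->
  smooth_on AM AN D f -> smooth_on AN AP E g -> smooth_on AM AP D (g \o f).
Proof.
move=> [okM _ _] [okN covN _] [okP _ _] oD oE DE [cf sf] [cg sg].
split=> [x Dx|c d Ac Ad].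
  by apply: continuous_comp; [exact: cf|exact/cg/DE].
have [oc _ cK _ _] := okM c Ac; have [od _ _ _ _] := okP d Ad.
apply: class_Coo_local => _ [x [[cx Dx] dx] <-].
have [e Ae ex] := covN (f x); have [oe _ eK _ _] := okN e Ae.
set V := E `&` g @^-1` cdom d; have oV : open V by exact: open_setI_preimage.
(* [U] is cut down so that [f] lands in the domain of [e] and [g \o f] in that of [d]; only there is
   the factorization through [e] valid. *)
set U := cdom c `&` (D `&` f @^-1` (cdom e `&` V)).
exists (cmap c @` U).
  by exists x => //; split=> //; split=> //; split=> //; split=> //; exact: DE.
have oU : open U.
  by apply: openI => //; apply: open_setI_preimage => //; exact: openI.
have oW : open (cmap e @` (cdom e `&` V)).
  by apply: chart_open_image => [||y []//]; [exact: okN|exact: openI].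
have oU' : open (cmap c @` U).
  by apply: chart_open_image => // [|y []//]; exact: okM.
have UW y : (cmap c @` U) y ->
    (cmap e @` (cdom e `&` V)) ((cmap e \o f \o cinv c) y).
  by move=> [z [cz [Dz fz]] <-] /=; rewrite cK//; exists (f z).
apply: (@class_Coo_ext _ _ _ _
  ((cmap d \o g \o cinv e) \o (cmap e \o f \o cinv c))) => //.
  by move=> _ [z [cz [Dz [ez _]]] <-] /=; rewrite cK// eK.
apply: class_Coo_comp oU' oW UW _ _.
  apply: class_Coo_sub (sf c e Ac Ae) => _ [z [cz [Dz [ez _]]] <-].
  by exists z.
apply: class_Coo_sub (sg e d Ae Ad) => _ [z [ez [Ez dz]] <-].
by exists z.
Qed.

End SmoothMaps.

(** * Products of smooth manifolds *)

Section Products.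
Context {R : realType}.
Implicit Types (m n l : nat) (M N P : topologicalType).

(** Concatenation becomes a sum of two linear maps, so its regularity reduces to linear maps and
    sums. *)
Lemma row_mxE_mul m n (x : 'rV[R]_m) (y : 'rV[R]_n) :
  row_mx x y = x *m row_mx 1%:M 0 + y *m row_mx 0 1%:M.
Proof. by rewrite !mul_mx_row !mulmx1 !mulmx0 add_row_mx addr0 add0r. Qed.

Lemma continuous_row_mx m n (T : topologicalType) (f : T -> 'rV[R]_m)
  (g : T -> 'rV[R]_n) (x : T) :
  {for x, continuous f} -> {for x, continuous g} ->
  {for x, continuous (fun y => row_mx (f y) (g y))}.
Proof.
move=> cf cg.
rewrite (_ : (fun y => row_mx (f y) (g y)) =
  fun y => f y *m row_mx 1%:M 0 + g y *m row_mx 0 1%:M); last first.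
  by apply/funext => y; rewrite row_mxE_mul.
have mulc p q (L : 'M[R]_(p, q)) (h : T -> 'rV[R]_p) :
    {for x, continuous h} -> {for x, continuous (fun y => h y *m L)}.
  move=> ch.
  exact: (cvg_comp _ _ ch (@linear_rV_continuous _ _ _ (mulmxr L) (h x))).
exact: (cvgD (mulc _ _ _ _ cf) (mulc _ _ _ _ cg)).
Qed.

Lemma class_Coo_row_mx m n l (A : set 'rV[R]_l) (f : 'rV[R]_l -> 'rV[R]_m)
  (g : 'rV[R]_l -> 'rV[R]_n) : open A ->
  class_Coo A f -> class_Coo A g -> class_Coo A (fun x => row_mx (f x) (g x)).
Proof.
move=> oA cf cg k; under eq_fun do rewrite row_mxE_mul.
have mulc p q (L : 'M[R]_(p, q)) (h : 'rV[R]_l -> 'rV[R]_p) :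
    class_C k A h -> class_C k A (fun y => h y *m L).
  move=> ch; apply: (@class_C_comp _ _ _ _ k A setT h (mulmxr L)) => //.
    exact: openT.
  exact: class_C_linear.
by apply: class_CD => //; exact: mulc.
Qed.

Lemma prod_chart_image m n M N (c : chart R m M) (d : chart R n N)
  (A : set M) (B : set N) :
  cmap (prod_chart c d) @` (A `*` B) =
  lsubmx @^-1` (cmap c @` A) `&` rsubmx @^-1` (cmap d @` B).
Proof.
apply/seteqP; split=> [_ [[x y] [/= Ax By] <-]|v [[x Ax xE] [y By yE]]] /=.
  by rewrite row_mxKl row_mxKr; split; [exists x|exists y].
by exists (x, y) => //=; rewrite xE yE hsubmxK.
Qed.

Lemma open_submx_preimage m n (A : set 'rV[R]_m) (B : set 'rV[R]_n) :
  open A -> open B ->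
  open ((lsubmx : 'rV[R]_(m + n) -> 'rV[R]_m) @^-1` A `&`
        (rsubmx : 'rV[R]_(m + n) -> 'rV[R]_n) @^-1` B).
Proof.
move=> oA oB; apply: openI; apply: open_comp => // v _.
  exact: continuous_lsubmx.
exact: continuous_rsubmx.
Qed.

Lemma smooth_structure_prod m n M N (AM : atlas R m M) (AN : atlas R n N) :
  smooth_structure AM -> smooth_structure AN ->
  smooth_structure (prod_atlas AM AN).
Proof.
move=> [okM covM trM] [okN covN trN]; split.
- move=> _ [c Ac [d Ad <-]].
  have [oc oic cK cc cic] := okM c Ac; have [od oid dK cd cid] := okN d Ad.
  split=> [|||[x y] [/= cx dy]|v].
  + rewrite openE => -[x y] [/= cx dy]; exists (cdom c, cdom d) => //.
    by split; exact: open_nbhs_nbhs.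
  + by rewrite /cimg prod_chart_image; exact: open_submx_preimage.
  + by move=> [x y] [/= cx dy]; rewrite row_mxKl row_mxKr cK// dK.
  + apply: continuous_row_mx.
      by apply: continuous_comp; [exact: cvg_fst|exact: cc].
    by apply: continuous_comp; [exact: cvg_snd|exact: cd].
  + rewrite /cimg prod_chart_image => -[/= cv dv].
    have cl : {for v, continuous (cinv c \o lsubmx)}.
      by apply: continuous_comp; [exact: continuous_lsubmx|exact: cic].
    have cr : {for v, continuous (cinv d \o rsubmx)}.
      by apply: continuous_comp; [exact: continuous_rsubmx|exact: cid].
    exact: (cvg_pair cl cr).
- move=> [x y]; have [c Ac cx] := covM x; have [d Ad dy] := covN y.
  by exists (prod_chart c d) => //; exists c => //; exists d.
- move=> _ _ [c Ac [d Ad <-]] [c' Ac' [d' Ad' <-]].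
  have [oc _ _ _ _] := okM c Ac; have [oc' _ _ _ _] := okM c' Ac'.
  have [od _ _ _ _] := okN d Ad; have [od' _ _ _ _] := okN d' Ad'.
  have oA : open (cmap c @` (cdom c `&` cdom c')).
    by apply: chart_open_image => [||x []//]; [exact: okM|exact: openI].
  have oB : open (cmap d @` (cdom d `&` cdom d')).
    by apply: chart_open_image => [||x []//]; [exact: okN|exact: openI].
  have -> : cdom (prod_chart c d) `&` cdom (prod_chart c' d') =
      (cdom c `&` cdom c') `*` (cdom d `&` cdom d') by rewrite setXI.
  rewrite prod_chart_image; have oAB := open_submx_preimage oA oB.
  (* Each block of the transition map is a linear projection followed by a transition map of one
     factor. *)
  apply: class_Coo_row_mx => //.
    apply: (class_Coo_comp (B := cmap c @` (cdom c `&` cdom c')) (f := lsubmx)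
      (g := cmap c' \o cinv c)) => //; last exact: trM.
    + by move=> v [].
    + by move=> k; exact: class_C_linear.
  apply: (class_Coo_comp (B := cmap d @` (cdom d `&` cdom d')) (f := rsubmx)
    (g := cmap d' \o cinv d)) => //; last exact: trN.
  + by move=> v [].
  + by move=> k; exact: class_C_linear.
Qed.

(** In charts the projection is [lsubmx] followed by a transition map of [AM]. *)
Lemma smooth_on_fst m n M N (AM : atlas R m M) (AN : atlas R n N)
  (D : set (M * N)) : smooth_structure AM ->
  smooth_on (prod_atlas AM AN) AM D fst.
Proof.
move=> [okM covM trM]; split=> [x _|_ c' [c Ac [d Ad <-]] Ac'].
  exact: cvg_fst.
have [oc _ _ _ _] := okM c Ac; have [oc' _ _ _ _] := okM c' Ac'.
pose A := cmap c @` (cdom c `&` cdom c').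
have oA : open A.
  by apply: chart_open_image => [||x []//]; [exact: okM|exact: openI].
have olA := open_submx_preimage oA (@openT 'rV[R]_n).
apply: (@class_Coo_sub _ _ _ _ (lsubmx @^-1` A `&` rsubmx @^-1` setT)).
  by move=> _ [[x y] [[[/= cx dy] _] cx'] <-];
    rewrite /= row_mxKl; split=> //; exists x.
apply: (class_Coo_comp (B := A) (f := lsubmx) (g := cmap c' \o cinv c)) => //.
- by move=> v [].
- by move=> k; exact: class_C_linear.
- exact: trM.
Qed.

Lemma smooth_on_pair m n l M N P (AM : atlas R m M) (AN : atlas R n N)
  (AP : atlas R l P) (D : set P) (f : P -> M) (g : P -> N) :
  smooth_structure AM -> smooth_structure AN -> smooth_structure AP -> open D ->
  smooth_on AP AM D f -> smooth_on AP AN D g ->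
  smooth_on AP (prod_atlas AM AN) D (fun x => (f x, g x)).
Proof.
move=> [okM _ _] [okN _ _] [okP _ _] oD [cf sf] [cg sg].
split=> [x Dx|e _ Ae [c Ac [d Ad <-]]].
  exact: (cvg_pair (cf x Dx) (cg x Dx)).
have [oc _ _ _ _] := okM c Ac; have [od _ _ _ _] := okN d Ad.
have [oe _ _ _ _] := okP e Ae.
rewrite (_ : _ `&` _ =
  cdom e `&` ((D `&` f @^-1` cdom c) `&` (D `&` g @^-1` cdom d))).
  apply: class_Coo_row_mx.
  - apply: chart_open_image => [||x []//]; first exact: okP.
    by apply: openI => //; apply: openI; exact: open_setI_preimage.
  - apply: class_Coo_sub (sf e c Ae Ac) => _ [x [ex [[Dx cx] _]] <-].
    by exists x.
  - apply: class_Coo_sub (sg e d Ae Ad) => _ [x [ex [_ [Dx dx]]] <-].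
    by exists x.
by apply/seteqP; split=> x /=; [move=> [[? ?] []]|move=> [? [[? ?] [? ?]]]].
Qed.

End Products.

(** * Discrete groups and covering actions *)

Lemma open_setX (S T : topologicalType) (A : set S) (B : set T) :
  open A -> open B -> open (A `*` B).
Proof.
move=> oA oB; rewrite openE => -[x y] [/= Ax By]; exists (A, B) => //.
by split; exact: open_nbhs_nbhs.
Qed.

Section DiscreteManifold.
Context {R : realType}.

Lemma discrete_atlas_structure (G : discreteTopologicalType) :
  smooth_structure (discrete_atlas R G).
Proof.
split.
- move=> _ [g _ <-]; split => /=.
  + exact: discrete_open.
  (* The space ['rV_0] has a single point, so the image of a singleton chart is everything. *)
  + rewrite (_ : cimg _ = setT); first exact: openT.
    by apply/seteqP; split=> // v _; exists g => //=; rewrite thinmx0.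
  + by move=> _ ->.
  + by move=> ? _; exact: cst_continuous.
  + by move=> ? _; exact: cst_continuous.
- by move=> g; exists (Chart [set g] (fun=> 0) (fun=> g)) => //; exists g.
- by move=> _ _ [g _ <-] [h _ <-] k; exact: class_C_cst.
Qed.

Lemma discrete_second_countable (G : discreteTopologicalType) :
  countable [set: G] -> @second_countable G.
Proof.
move=> cG; exists (range set1).
  exact: sub_countable (card_image_le _ _) cG.
split=> [U _|g A gA]; first exact: discrete_open.
exists [set g]; first by split=> //; exists g.
by move=> _ ->; exact: nbhs_singleton gA.
Qed.

(** Serves to replace a locally constant component by a constant near each point. *)
Lemma smooth_on_locally (m n : nat) (M N : topologicalType) (AM : atlas R m M)
  (AN : atlas R n N) (D : set M) (f : M -> N) :
  smooth_structure AM -> smooth_structure AN ->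
  (forall x, D x -> exists E g, [/\ open E, E x,
     (forall y, E y -> g y = f y) & smooth_on AM AN E g]) ->
  smooth_on AM AN D f.
Proof.
move=> sM sN Df; apply: smooth_on_local => x /Df[E [g [oE Ex gf sg]]].
by exists E => //; exact: smooth_on_ext gf sg.
Qed.

(** Each slice over a point of [G] is open, and on it [f] factors through the first projection. *)
Lemma smooth_on_discrete_fibers (m n : nat) (M N : topologicalType)
  (G : discreteTopologicalType) (AM : atlas R m M) (AN : atlas R n N)
  (D : set M) (f : M * G -> N) :
  smooth_structure AM -> smooth_structure AN -> open D ->
  (forall g, smooth_on AM AN D (fun x => f (x, g))) ->
  smooth_on (prod_atlas AM (discrete_atlas R G)) AN (D `*` setT) f.
Proof.
move=> sM sN oD sf; have sG := discrete_atlas_structure G.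
have sMG := smooth_structure_prod sM sG.
apply: smooth_on_locally => // -[x g] [/= Dx _].
have oDg : open (D `*` [set g]) by apply: open_setX => //; exact: discrete_open.
exists (D `*` [set g]), ((fun y => f (y, g)) \o fst); split=> //.
  by move=> [y h] [/= _ ->].
apply: smooth_on_comp oDg oD _ _ (sf g) => //; first by move=> y [].
exact: smooth_on_fst.
Qed.

Lemma lie_group_discrete (G : discreteGroupType) :
  lie_group (discrete_atlas R G).
Proof.
have sG := discrete_atlas_structure G.
have sGG := smooth_structure_prod sG sG.
split=> //; first exact: discrete_hausdorff.
- rewrite -setXTT; apply: smooth_on_discrete_fibers => //; first exact: openT.
  move=> h; apply: smooth_on_locally => // g _.
  exists [set g], (fun=> (g * h)%g); split=> //; first exact: discrete_open.
    by move=> _ ->.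
  exact: smooth_on_cst.
- apply: smooth_on_locally => // g _.
  exists [set g], (fun=> (g^-1)%g); split=> //; first exact: discrete_open.
    by move=> _ ->.
  exact: smooth_on_cst.
Qed.

End DiscreteManifold.

Section CoveringAction.
Context {X : topologicalType} {G : groupType} (a : right_action X G).

Lemma orbit_pi_act x g : orbit_pi a (a x g) = orbit_pi a x.
Proof. by apply/esym/eqmodP; apply/asboolP; exists g. Qed.

Lemma orbit_pi_eq x y : orbit_pi a x = orbit_pi a y -> exists g, y = a x g.
Proof. by move/eqmodP => /asboolP. Qed.

(** The element [g * h^-1] fixes [x], so [x] lies both in [U] and in its translate by [g * h^-1];
    these would be disjoint if that element were not the identity. *)
Lemma covering_action_free x g h : covering_action a -> a x g = a x h -> g = h.
Proof.
move=> cov gh; have [U /nbhs_singleton Ux dU] := cov x.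
apply: (@mulIg _ h^-1%g); rewrite mulgV; apply: contrapT => /dU U0.
suff : (U `&` (a^~ (g * h^-1)%g @` U)) x by rewrite U0.
by split=> //; exists x; rewrite // actM gh -actM mulgV act1.
Qed.

(** Choosing for each [g] a basic open set [W g] around the point [a x g] inside the translate of
    [U] by [g] injects [G] into a countable base: if [W g = W h], then [U] meets its translate by
    [g * h^-1], whence [g = h]. *)
Lemma covering_action_countable :
  covering_action a -> (forall g, continuous (a^~ g)) ->
  @second_countable X -> [set: X] !=set0 -> countable [set: G].
Proof.
move=> cov ca [B cB [_ basisB]] [x _]; have [U xU dU] := cov x.
have /choice[W WP] : forall g, exists V,
    [/\ B V, V (a x g) & V `<=` a^~ (g^-1)%g @^-1` U].
  move=> g; have : nbhs (a x g) (a^~ (g^-1)%g @^-1` U).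
    by apply: ca; rewrite -actM mulgV act1.
  by move=> /basisB[V [BV Vx] VU]; exists V.
have injW : {in [set: G] &, injective W}.
  move=> g h _ _ Wgh; apply: (@mulIg _ h^-1%g); rewrite mulgV.
  apply: contrapT => /dU U0.
  have [_ Wg _] := WP g; have [_ _ Wh] := WP h.
  suff : (U `&` (a^~ (g * h^-1)%g @` U)) (a x (g * h^-1)%g) by rewrite U0.
  split; last by exists x => //; exact: nbhs_singleton.
  by rewrite actM; apply: Wh; rewrite -Wgh.
rewrite -(eq_countable (inj_card_eq injW)).
apply: sub_countable cB; apply: subset_card_le => _ [g _ <-].
by have [] := WP g.
Qed.

End CoveringAction.

(** * Local trivializations from sheets of the orbit map *)

Section Trivialization.
Context {R : realType} {n m : nat} {G : discreteGroupType}
  {X B : topologicalType}.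
Context (AX : atlas R n X) (AB : atlas R m B) (a : right_action X G).

Lemma discrete_bundle_smooth (p : X -> B) :
  discrete_bundle AX AB a p -> smooth_on AX AB setT p.
Proof.
move=> [[sX _ _] [sB _ _] _ [AQ [sQ locpi [f [_ _ sf _] ->]]]].
apply: smooth_on_comp sf => //; [exact: openT|exact: openT|].
by apply: smooth_on_local => x _; have [U Ux [_ _ spi _]] := locpi x; exists U.
Qed.

Lemma local_trivialization (p : X -> B) (x : X) :
  discrete_bundle AX AB a p -> smooth_discrete_action AX a ->
  exists V (psi : B * G -> X),
  [/\ open V, V (p x),
      diffeo_on (prod_atlas AB (discrete_atlas R G)) AX (V `*` setT)
        (p @^-1` V) psi,
      (forall b g, V b -> p (psi (b, g)) = b) &
      (forall b g h, V b -> psi (b, (g * h)%g) = a (psi (b, g)) h)].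
Proof.
move=> bundle sa; have sp := discrete_bundle_smooth bundle; move: bundle.
move=> [[sX _ _] [sB _ _] [cov _] [AQ [sQ locpi [f fdiff pE]]]].
have [_ _ _ [fi [sfi fK fiK]]] := fdiff.
have {}fK q : fi (f q) = q by have [] := fK q I.
have {}fiK b : f (fi b) = b by have [] := fiK b I.
have pa y g : p (a y g) = p y by rewrite pE /= orbit_pi_act.
have fip y : fi (p y) = orbit_pi a y by rewrite pE /= fK.
have [U Ux [oU oW _ [s [ss sK Ks]]]] := locpi x.
set W := orbit_pi a @` U in oW ss Ks.
(* Since [fi] is the inverse of [f], [V] is the part of [B] corresponding to the orbits that meet
   the sheet [U]. *)
pose V := fi @^-1` W.
have oV : open V by apply: open_comp => // b _; apply: (sfi.1 b).
have sG := discrete_atlas_structure (R := R) G.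
have sBG := smooth_structure_prod sB sG.
have cp y : {for y, continuous p} by exact: sp.1.
have oVp : open (p @^-1` V) by apply: open_comp => // y _; exact: cp.
(* [h y] is the group coordinate of [y]: it carries the point of the section over [p y] to [y].
   Outside the preimage of [V], the value 1 is a mere default. *)
have /choice[h hP] : forall y, exists g, V (p y) -> y = a (s (fi (p y))) g.
  move=> y.
  have [Vy|nVy] := pselect (V (p y)); last by exists 1%g.
  have [_] := Ks _ Vy; rewrite fip => /orbit_pi_eq[g gE].
  by exists g.
exists V, (fun u => a (s (fi u.1)) u.2); split=> //=.
- by rewrite /V /= fip; exists x.
- split=> //.
  + exact: open_setX openT.
  + apply: smooth_on_discrete_fibers => // g.
    apply: (@smooth_on_comp _ _ _ _ _ _ _ AB AX AX V setT
      (s \o fi) (a^~ g)) => //.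
      exact: openT.
    apply: smooth_on_comp oV oW _ _ ss => //.
    exact: smooth_on_sub sfi.
  + exists (fun y => (p y, h y)); split.
    * apply: smooth_on_locally => // y Vy.
      have ca : continuous (a^~ (h y)^-1)%g by move=> z; exact: (sa _).1.
      (* [E] is the translate of the sheet [U] by [h y], an open neighborhood of [y] on which [h]
         will be constant over [V]. *)
      set E := a^~ (h y)^-1%g @^-1` U.
      have oE : open E by apply: open_comp => // z _; exact: ca.
      exists (p @^-1` V `&` E), (fun z => (p z, h y)); split.
      - exact: openI.
      - split=> //; rewrite /E /= {1}(hP y Vy) -actM mulgV act1.
        by have [] := Ks _ Vy.
      (* Translating [z] by the inverse of [h y] gives a point of [U] in the orbit of [z], hence the
         value of the section there. So [h y] and [h z] both carry that value to [z], and freeness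
         identifies them. *)
      - move=> z [Vz Ez]; congr pair.
        apply: (covering_action_free (x := s (fi (p z))) cov).
        rewrite -(hP z Vz) fip -(orbit_pi_act a z (h y)^-1%g).
        by have [_ ->] := sK _ Ez; rewrite -actM mulVg act1.
      - apply: smooth_on_pair => //; first exact: openI.
          exact: smooth_on_sub sp.
        exact: smooth_on_cst.
    * move=> [b g] [/= Vb _].
      have pb : p (a (s (fi b)) g) = b.
        by rewrite pa pE /=; have [_ ->] := Ks _ Vb.
      rewrite pb; split=> //; congr pair.
      (* Both [g] and the group coordinate of the image of [(b, g)] carry [s (fi b)] to that same
         image. *)
      apply: (covering_action_free (x := s (fi b)) cov).
      by apply/esym; have := hP (a (s (fi b)) g); rewrite pb; exact.
    * by move=> y Vy; rewrite /= -hP.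
- by move=> b g Vb; rewrite pa pE /=; have [_ ->] := Ks _ Vb.
- by move=> b g g' _; rewrite actM.
Qed.

End Trivialization.

(** * The principal bundle, and second countability of the group *)

Theorem theorem4p9 (R : realType) (n m : nat) (G : discreteGroupType)
    (X B : topologicalType) (AX : atlas R n X) (AB : atlas R m B)
    (a : right_action X G) (p : X -> B)
    (hbundle : discrete_bundle AX AB a p)
    (hsmooth : smooth_discrete_action AX a) :
  smooth_principal_bundle AX AB (discrete_atlas R G) a p /\
  ([set: X] !=set0 -> smooth_manifold (discrete_atlas R G)).
Proof.
have [mX mB [cov _] [AQ [_ _ [f [_ _ _ [fi [_ _ fiK]]] pE]]]] := hbundle.
have [sX _ X2] := mX.
have sp := discrete_bundle_smooth hbundle.
have surjp b : exists x, p x = b.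
  (* Any representative of the orbit corresponding to [b] is a preimage. *)
  have [_ fb] := fiK b I; exists (repr (fi b)).
  by rewrite pE /= /orbit_pi reprK.
have sG := discrete_atlas_structure (R := R) G.
split; last first.
  (* [lie_group] leaves out second countability; a point of [X] supplies it, since its orbit forces
     [G] to be countable. *)
  move=> X0; split=> //; first exact: discrete_hausdorff.
  apply: discrete_second_countable.
  apply: covering_action_countable cov _ X2 X0.
  by move=> g x; exact: (hsmooth g).1.
split; first by split=> //; exact: lie_group_discrete.
split=> //.
  rewrite -setXTT; apply: smooth_on_discrete_fibers => //; exact: openT.
have /choice[V /choice[psi triv]] :=
  fun x => local_trivialization x hbundle hsmooth.
(* The cover is indexed by the points of [X]: [V x] contains [p x], so surjectivity of [p] makes
   these sets cover [B]. *)
exists X, V, psi; split=> [x||x|x|x]; try by have [] := triv x.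
by apply/seteqP; split=> // b _; have [x <-] := surjp b; exists x => //;
  have [] := triv x.
Qed.
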